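(* Let $P\subset\mathbb{R}^D$ be an $(\epsilon_1,\epsilon_2)$-significant instance of $k$-center clustering with $z$ outliers, $|P|=n$, and let $\eta,\delta\in(0,1)$. Consider the following algorithm: (1) sample a set $S$ of $\frac{3k}{\delta^2\epsilon_1}\log\frac{2k}{\eta}$ points uniformly at random from $P$; (2) let $z'=\frac{1}{\eta}\frac{\epsilon_2}{k}|S|$ and solve $k$-center clustering with $z'$ outliers on $S$ using any $c$-approximation algorithm with $c\ge 1$; output the set $H$ of $k$ returned centers. If $\frac{\epsilon_1}{\epsilon_2}>\frac{1}{\eta(1-\delta)}$, then with probability at least $(1-\eta)^2$, $\Delta^{-z}_{\infty}(P,H)\le(c+2)r_{opt}$.
   Context: For a finite $H\subset\mathbb{R}^D$ and a point $p$, $dist(p,H)=\min_{q\in H}\|p-q\|$. For a finite point set $Q$ and integer $0<w<|Q|$, $\Delta^{-w}_{\infty}(Q,H)=\min\{\max_{p\in Q'}dist(p,H): Q'\subset Q, |Q'|=|Q|-w\}$. The $k$-center clustering with $w$ outliers problem on $Q$ asks for $k$ centers $C\subset\mathbb{R}^D$ minimizing $\Delta^{-w}_{\infty}(Q,C)$; a $c$-approximation algorithm returns $k$ centers whose value is at most $c$ times the optimum. $r_{opt}$ is the optimal value for $P$ with $z$ outliers. $P_{opt}\subset P$ with $|P_{opt}|=n-z$ denotes the set of inliers of an optimal solution for $P$, and $C^*_1,\dots,C^*_k$ the optimal clusters forming $P_{opt}$. The instance is $(\epsilon_1,\epsilon_2)$-significant ($\epsilon_1,\epsilon_2>0$) if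 $\min_j|C^*_j|\ge\frac{\epsilon_1}{k}n$ and $z=\frac{\epsilon_2}{k}n$. Sampling uniformly at random means each sample point is drawn independently and uniformly from $P$ ($S$ is regarded as a multiset). *)

(* Defs.v *)
From mathcomp Require Import all_boot all_order all_algebra.
From mathcomp Require Import classical_sets reals exp.
Set Implicit Arguments. Unset Strict Implicit. Unset Printing Implicit Defensive.
Import Order.TTheory GRing.Theory Num.Theory.
Local Open Scope ring_scope.
Local Open Scope classical_set_scope.

Section Defs.
Variables (R : realType) (D : nat).

Definition edist (p q : 'rV[R]_D) : R :=
  Num.sqrt (\sum_(i < D) (p ord0 i - q ord0 i) ^+ 2).

Definition distC (k : nat) (p : 'rV[R]_D) (H : 'I_k -> 'rV[R]_D) : R :=
  inf [set edist p (H i) | i in [set: 'I_k]].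

(* Delta^{-w}_infty(Q,H) for a (multi)set Q indexed by 'I_m:
   min over sub-multisets Q' of size m - w of max_{p in Q'} dist(p,H). *)
Definition Delta (m : nat) (Q : 'I_m -> 'rV[R]_D) (w : nat) (k : nat)
    (H : 'I_k -> 'rV[R]_D) : R :=
  inf [set (\big[Num.max/0]_(i in A) distC (Q i) H)
       | A in [set A : {set 'I_m} | #|A| = (m - w)%N]].

Definition kc_opt (m : nat) (Q : 'I_m -> 'rV[R]_D) (w k : nat) : R :=
  inf [set Delta Q w H | H in [set: 'I_k -> 'rV[R]_D]].

Definition significant (n : nat) (P : 'I_n -> 'rV[R]_D) (k z : nat)
    (e1 e2 : R) : Prop :=
  z%:R = e2 / k%:R * n%:R /\
  exists (Copt : 'I_k -> 'rV[R]_D) (Popt : {set 'I_n}) (f : 'I_n -> 'I_k),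
    [/\ Delta P z Copt = kc_opt P z k,
        #|Popt| = (n - z)%N,
        (forall i, i \in Popt ->
           edist (P i) (Copt (f i)) = distC (P i) Copt /\
           distC (P i) Copt <= kc_opt P z k) &
        (forall j : 'I_k, e1 / k%:R * n%:R <= #|[set i in Popt | f i == j]|%:R)].

End Defs.

(* Main.v *)
(** Call a sample representative if it contains at most [z'] outliers and more
    than [z'] points of every optimal cluster.  On a representative sample the
    bound holds deterministically.  Each of the two conditions has probability
    at least [1 - eta]: the first by Markov's inequality, the second by a
    Chernoff bound on each cluster.  The conditions are not independent, and a
    union bound only gives [1 - 2 * eta]; but replacing an outlier by an inlier
    favours both, so they are positively correlated and their probabilities may
    be multiplied. *)

Require Import Defs.
From mathcomp Require Import boolp classical_sets reals sequences exp.
From mathcomp Require Import all_boot all_order all_algebra.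
From mathcomp Require Import zify ring lra.
Set Implicit Arguments.
Unset Strict Implicit.
Unset Printing Implicit Defensive.
Import Order.TTheory GRing.Theory Num.Theory.
Local Open Scope ring_scope.

Lemma binet_cauchy (R : comPzRingType) (I : finType) (a b c d : I -> R) :
  \sum_i \sum_j (a i * b j - a j * b i) * (c i * d j - c j * d i) =
  2 * ((\sum_i a i * c i) * (\sum_i b i * d i)
       - (\sum_i a i * d i) * (\sum_i b i * c i)).
Proof.
have expand i j : (a i * b j - a j * b i) * (c i * d j - c j * d i) =
    a i * c i * (b j * d j) - a i * d i * (b j * c j)
    - b i * c i * (a j * d j) + b i * d i * (a j * c j) by ring.
under eq_bigr => i _ do
  (under eq_bigr do rewrite expand; rewrite big_split !sumrB -!mulr_sumr).
by rewrite big_split !sumrB -!mulr_suml /=; ring.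
Qed.

Lemma cauchy_schwarz_sum (R : realDomainType) (I : finType) (a b : I -> R) :
  (\sum_i a i * b i) ^+ 2 <= (\sum_i a i ^+ 2) * (\sum_i b i ^+ 2).
Proof.
have : 0 <= \sum_i \sum_j (a i * b j - a j * b i) * (a i * b j - a j * b i).
  by apply: sumr_ge0 => i _; apply: sumr_ge0 => j _; rewrite -expr2 sqr_ge0.
rewrite binet_cauchy pmulr_rge0 // subr_ge0.
by under [\sum_i b i * a i]eq_bigr do rewrite mulrC.
Qed.

Lemma chebyshev_sum (R : numDomainType) (I : finType) (f g : I -> R) :
  (forall i j, 0 <= (f i - f j) * (g i - g j)) ->
  (\sum_i f i) * (\sum_i g i) <= #|I|%:R * \sum_i f i * g i.
Proof.
move=> fg.
have : 0 <= \sum_i \sum_j (f i * 1 - f j * 1) * (g i * 1 - g j * 1).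
  by apply: sumr_ge0 => i _; apply: sumr_ge0 => j _; rewrite !mulr1.
rewrite (binet_cauchy f (fun=> 1) g (fun=> 1)) pmulr_rge0 // subr_ge0.
under [\sum_i 1 * g i]eq_bigr do rewrite mul1r.
under [\sum_i f i * 1]eq_bigr do rewrite mulr1.
by rewrite mulr1 sumr_const [leRHS]mulrC.
Qed.

(** * Uniform means and probabilities *)

Section UniformMean.
Variable R : numFieldType.

Definition mean (T : finType) (F : T -> R) : R := (\sum_x F x) / #|T|%:R.

Definition prob (T : finType) (A : {set T}) : R := #|A|%:R / #|T|%:R.

Section OneType.
Variable T : finType.
Implicit Types (F G : T -> R) (A B : {set T}).

Lemma prob_mean A : prob A = mean (fun x => (x \in A)%:R).
Proof. by rewrite /mean -natr_sum -big_mkcond sum1_card. Qed.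

Lemma eq_mean F G : F =1 G -> mean F = mean G.
Proof. by move=> FG; congr (_ / _); apply: eq_bigr => x _. Qed.

Lemma le_mean F G : (forall x, F x <= G x) -> mean F <= mean G.
Proof. by move=> FG; rewrite ler_wpM2r ?invr_ge0 ?ler_sum. Qed.

Lemma meanZ (a : R) F : mean (fun x => a * F x) = a * mean F.
Proof. by rewrite /mean -mulr_sumr mulrA. Qed.

Lemma mean_sum (I : finType) (F : I -> T -> R) :
  mean (fun x => \sum_i F i x) = \sum_i mean (F i).
Proof. by rewrite /mean exchange_big mulr_suml. Qed.

Lemma mean_cst (a : R) : (0 < #|T|)%N -> mean (fun _ : T => a) = a.
Proof.
move=> T_gt0; rewrite /mean sumr_const -[a *+ _]mulr_natr.
by rewrite mulfK // pnatr_eq0 -lt0n.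
Qed.

Lemma mean_chebyshev F G :
  (forall x y, 0 <= (F x - F y) * (G x - G y)) ->
  mean F * mean G <= mean (fun x => F x * G x).
Proof.
move=> FG; have [T_eq0|T_gt0] := posnP #|T|.
  by rewrite /mean T_eq0 invr0 !mulr0.
have T_gt0R : 0 < #|T|%:R :> R by rewrite ltr0n.
rewrite mulrACA mulrA !ler_pdivrMr // divfK ?gt_eqF //.
by rewrite [leRHS]mulrC chebyshev_sum.
Qed.

Lemma markov F (a : R) : (forall x, 0 <= F x) -> 0 < a ->
  prob [set x | a <= F x] <= mean F / a.
Proof.
move=> F0 a0; rewrite ler_pdivlMr // prob_mean mulrC -meanZ.
apply: le_mean => x; rewrite inE.
by case: (boolP (a <= F x)); rewrite ?mulr1 ?mulr0.
Qed.

Lemma prob_ge0 A : 0 <= prob A.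
Proof. by rewrite divr_ge0. Qed.

Lemma le_prob A B : A \subset B -> prob A <= prob B.
Proof.
by move=> AB; rewrite ler_wpM2r ?invr_ge0 // ler_nat subset_leq_card.
Qed.

Lemma prob_le1 A : prob A <= 1.
Proof.
have [T_eq0|T_gt0] := posnP #|T|; first by rewrite /prob T_eq0 invr0 mulr0.
by rewrite ler_pdivrMr ?ltr0n // mul1r ler_nat max_card.
Qed.

Lemma prob_setC A : (0 < #|T|)%N -> prob (~: A) = 1 - prob A.
Proof.
move=> T_gt0; rewrite /prob -(cardsC A) natrD.
by field; rewrite -natrD cardsC pnatr_eq0 -lt0n.
Qed.

Lemma prob_bigcup (I : finType) (A : I -> {set T}) :
  prob (\bigcup_i A i) <= \sum_i prob (A i).
Proof.
rewrite -mulr_suml ler_wpM2r ?invr_ge0 // -natr_sum ler_nat.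
elim/big_rec2: _ => [|i n B _ Bn]; first by rewrite cards0.
by apply: leq_trans (leq_card_setU _ _) _; rewrite leq_add2l.
Qed.

End OneType.

Section Samples.
Variables I T : finType.

Lemma mean_prod (g : I -> T -> R) :
  mean (fun s : {ffun I -> T} => \prod_i g i (s i)) = \prod_i mean (g i).
Proof.
by rewrite /mean -bigA_distr_bigA prodf_div prodr_const card_ffun natrX.
Qed.

Hypothesis T_gt0 : (0 < #|T|)%N.

Lemma mean_coord (g : T -> R) i :
  mean (fun s : {ffun I -> T} => g (s i)) = mean g.
Proof.
pose gi j x := if j == i then g x else 1.
transitivity (mean (fun s : {ffun I -> T} => \prod_j gi j (s j))).
  apply: eq_mean => s; rewrite (bigD1 i) //= {1}/gi eqxx big1 ?mulr1 // => j.
  by rewrite /gi => /negbTE ->.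
rewrite mean_prod (bigD1 i) //= big1 ?mulr1 /gi ?eqxx // => j /negbTE ->.
exact: mean_cst.
Qed.

Lemma card_preimset_sum (s : I -> T) (C : {set T}) :
  #|s @^-1: C| = (\sum_i (s i \in C))%N.
Proof. by rewrite -sum1dep_card big_mkcond. Qed.

Lemma mean_card_preimset (C : {set T}) :
  mean (fun s : {ffun I -> T} => #|s @^-1: C|%:R) = #|I|%:R * prob C.
Proof.
under eq_mean => s do rewrite card_preimset_sum natr_sum.
rewrite mean_sum prob_mean.
under eq_bigr => i _ do rewrite (mean_coord (fun x => (x \in C)%:R)).
by rewrite sumr_const mulr_natl.
Qed.

Lemma mean_expr_card_preimset (C : {set T}) (a : R) :
  mean (fun s : {ffun I -> T} => a ^+ #|s @^-1: C|) =
  (1 - prob C * (1 - a)) ^+ #|I|.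
Proof.
under eq_mean => s do rewrite card_preimset_sum -prodrXr.
rewrite (mean_prod (fun _ x => a ^+ (x \in C))) prodr_const; congr (_ ^+ _).
rewrite -[X in X - _](mean_cst 1 T_gt0) prob_mean mulrC -meanZ.
rewrite /mean -mulrBl -sumrB; congr (_ / _); apply: eq_bigr => x _.
by case: (x \in C); rewrite ?mulr1 ?subKr ?mulr0 ?subr0.
Qed.

Definition hits_le (C : {set T}) (w : nat) : {set {ffun I -> T}} :=
  [set s : {ffun I -> T} | #|s @^-1: C| <= w]%N.

Lemma markov_hits_le (C : {set T}) w (b : R) :
  #|I|%:R * prob C <= b * w.+1%:R -> 1 - b <= prob (hits_le C w).
Proof.
move=> Cb; rewrite -[hits_le C w]setCK prob_setC; last first.
  by rewrite card_ffun expn_gt0 T_gt0.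
rewrite lerD2l lerN2.
have -> : ~: hits_le C w =
    [set s : {ffun I -> T} | w.+1%:R <= #|s @^-1: C|%:R :> R].
  by apply/setP => s; rewrite !inE -ltnNge ler_nat.
apply: le_trans (markov _ _) _ => //.
by rewrite ler_pdivrMr // mean_card_preimset.
Qed.

End Samples.

(** * Positive correlation of sample events *)

Section Association.
Variable T : finType.

Definition ffun_cons m (x : T) (s : {ffun 'I_m -> T}) : {ffun 'I_m.+1 -> T} :=
  [ffun i => oapp s x (unlift ord0 i)].

Lemma mean_ffun_recl m (F : {ffun 'I_m.+1 -> T} -> R) :
  mean F = mean (fun x => mean (fun s => F (ffun_cons x s))).
Proof.
pose cons_pair (p : T * {ffun 'I_m -> T}) := ffun_cons p.1 p.2.
pose uncons (s : {ffun 'I_m.+1 -> T}) := (s ord0, [ffun j => s (lift ord0 j)]).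
have cons_bij : bijective cons_pair.
  exists uncons => [[x s]|s].
    rewrite /uncons ffunE unlift_none; congr (_, _).
    by apply/ffunP => j; rewrite !ffunE liftK.
  apply/ffunP => i; rewrite ffunE.
  by case: unliftP => [j|] -> //=; rewrite ffunE.
rewrite /mean (reindex cons_pair) /=; last exact: onW_bij.
rewrite -(pair_bigA _ (fun x s => F (cons_pair (x, s)))) /= -mulr_suml.
by rewrite -mulrA -invfM -natrM !card_ffun !card_ord expnSr.
Qed.

Lemma forall_ffun_cons m (r : rel T) x y (s t : {ffun 'I_m -> T}) :
  r x y -> (forall i, r (s i) (t i)) ->
  forall i, r (ffun_cons x s i) (ffun_cons y t i).
Proof. by move=> rxy rst i; rewrite !ffunE; case: unlift => [j|] /=. Qed.

Variables (d : Order.disp_t) (V : orderType d) (rank : T -> V).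
Implicit Types x y : T.

Definition eq_or_rank_lt x y := (x == y) || (rank x < rank y)%O.

(* The order making [F] decreasing is not total, so this is not Harris'
   inequality; it holds because two points of equal rank, which [F] may tell
   apart, are interchangeable for [G]. *)
Lemma mean_association m (F G : {ffun 'I_m -> T} -> R) :
  (forall s t : {ffun 'I_m -> T}, (forall i, eq_or_rank_lt (s i) (t i)) ->
    F t <= F s) ->
  (forall s t : {ffun 'I_m -> T}, (forall i, rank (s i) <= rank (t i))%O ->
    G t <= G s) ->
  mean F * mean G <= mean (fun s => F s * G s).
Proof.
elim: m F G => [|m IH] F G decF decG.
  apply: mean_chebyshev => s t.
  have -> : s = t by apply/ffunP => - [].
  by rewrite subrr mul0r.
rewrite !mean_ffun_recl; set f := fun x => mean _; set g := fun x => mean _.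
apply: (@le_trans _ _ (mean (fun x => f x * g x))); last first.
  apply: le_mean => x; apply: IH => s t st.
    by apply: decF; apply: forall_ffun_cons; rewrite /eq_or_rank_lt ?eqxx.
  by apply: decG; exact: (forall_ffun_cons (r := relpre rank <=%O) (lexx _) st).
have decf x y : (rank x < rank y)%O -> f y <= f x.
  move=> xy; apply: le_mean => s; apply: decF.
  by apply: forall_ffun_cons => [|i]; rewrite /eq_or_rank_lt ?xy ?eqxx ?orbT.
have decg x y : (rank x <= rank y)%O -> g y <= g x.
  move=> xy; apply: le_mean => s; apply: decG.
  exact: (forall_ffun_cons (r := relpre rank <=%O) xy (fun=> lexx _)).
apply: mean_chebyshev => x y; case: (ltgtP (rank x) (rank y)) => xy.
- by rewrite mulr_ge0 // subr_ge0 ?decf ?decg ?ltW.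
- by rewrite mulr_le0 // subr_le0 ?decf ?decg ?ltW.
- have -> : g x = g y by apply/eqP; rewrite eq_le !decg ?xy.
  by rewrite subrr mulr0.
Qed.

Lemma prob_association m (A B : {set {ffun 'I_m -> T}}) :
  (forall s t : {ffun 'I_m -> T}, (forall i, eq_or_rank_lt (s i) (t i)) ->
    t \in A -> s \in A) ->
  (forall s t : {ffun 'I_m -> T}, (forall i, rank (s i) <= rank (t i))%O ->
    t \in B -> s \in B) ->
  prob A * prob B <= prob (A :&: B).
Proof.
move=> downA downB; rewrite !prob_mean.
apply: le_trans (mean_association _ _) _ => [s t st|s t st|].
- by have := downA _ _ st; case: (t \in A) => [->|].
- by have := downB _ _ st; case: (t \in B) => [->|].
- by apply: le_mean => s; rewrite inE; case: (s \in A); rewrite ?mul1r ?mul0r.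
Qed.

End Association.

Section Representative.
Variables (T J : finType) (bad : {set T}) (C : J -> {set T}) (m w : nat).

Definition representative : {set {ffun 'I_m -> T}} :=
  hits_le 'I_m bad w :&: ~: \bigcup_j hits_le 'I_m (C j) w.

Lemma representativeP (s : {ffun 'I_m -> T}) :
  reflect ((#|s @^-1: bad| <= w)%N /\ forall j, (w < #|s @^-1: C j|)%N)
          (s \in representative).
Proof.
rewrite !inE; apply: (iffP andP) => -[few many]; split => //.
  move=> j; rewrite ltnNge; apply: contra many => many_j.
  by apply/bigcupP; exists j; rewrite ?inE.
by apply/bigcupP => -[j _]; rewrite inE leqNgt many.
Qed.

Lemma mul_prob_le_representative :
  (forall j, [disjoint bad & C j]) ->
  prob (hits_le 'I_m bad w) * prob (~: \bigcup_j hits_le 'I_m (C j) w) <=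
  prob representative.
Proof.
move=> bad_C; rewrite mulrC /representative setIC.
apply: (prob_association (rank := fun x => x \in bad)) => s t st.
- rewrite !inE; apply: contra => /bigcupP[j _]; rewrite inE => few_s.
  apply/bigcupP; exists j => //; rewrite inE; apply: leq_trans few_s.
  apply: subset_leq_card; apply/subsetP => i; rewrite !inE => ti_C.
  have /orP[/eqP -> //|] := st i.
  by rewrite (disjointFl (bad_C j) ti_C); case: (_ \in bad).
- rewrite !inE; apply: leq_trans; apply: subset_leq_card.
  apply/subsetP => i; rewrite !inE => si_bad.
  by have := st i; rewrite si_bad; case: (_ \in bad).
Qed.

End Representative.

End UniformMean.

(** * Tail bounds *)

Section Chernoff.
Variable R : realType.

Lemma expRN_le_quadratic (x : R) : 0 <= x ->
  expR (- x) <= 1 - x + 3 / 4 * x ^+ 2.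
Proof.
move=> x0; rewrite expRN.
have sqr_le_expR : (1 + x / 2) ^+ 2 <= expR x.
  rewrite [in leRHS](_ : x = x / 2 + x / 2); last by field.
  rewrite expRD -expr2 ler_sqr ?nnegrE ?expR_ge0 ?expR_ge1Dx //.
  by rewrite addr_ge0 // divr_ge0.
have sqr_gt0 : 0 < (1 + x / 2) ^+ 2.
  by rewrite exprn_gt0 // ltr_wpDr // divr_ge0.
apply: (@le_trans _ _ (((1 + x / 2) ^+ 2)^-1)).
  by rewrite lef_pV2 ?posrE ?expR_gt0.
rewrite -[leLHS]mul1r ler_pdivrMr // -subr_ge0.
rewrite (_ : _ - _ = x ^+ 3 * (2^-1 + 3 / 16 * x)); last by field.
by rewrite mulr_ge0 ?exprn_ge0 //; lra.
Qed.

Variables I T : finType.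
Hypothesis T_gt0 : (0 < #|T|)%N.

Lemma exp_markov_hits_le (C : {set T}) w (l : R) : 0 <= l ->
  prob R (hits_le I C w) <=
  expR (l * w%:R - #|I|%:R * prob R C * (1 - expR (- l))).
Proof.
move=> l0; set a := expR (- l).
have a_gt0 : 0 < a by apply: expR_gt0.
have a_le1 : a <= 1 by rewrite expR_le1 oppr_le0.
have hits_sub : hits_le I C w \subset
    [set s : {ffun I -> T} | a ^+ w <= a ^+ #|s @^-1: C|].
  by apply/subsetP => s; rewrite !inE => sCw; rewrite ler_wiXn2l // ltW.
apply: le_trans (le_prob R hits_sub) _.
apply: le_trans (markov _ _) _; [by move=> s; rewrite exprn_ge0 ?ltW|
                                 by rewrite exprn_gt0|].
have -> : expR (l * w%:R - #|I|%:R * prob R C * (1 - a)) =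
    expR (- (prob R C * (1 - a))) ^+ #|I| / a ^+ w.
  by rewrite /a -!expRM_natl -expRN -expRD; congr expR; ring.
rewrite mean_expr_card_preimset //.
rewrite ler_wpM2r ?invr_ge0 ?exprn_ge0 ?(ltW a_gt0) //.
rewrite lerXn2r ?nnegrE ?expR_ge0 ?expR_ge1Dx //.
by rewrite subr_ge0 mulr_ile1 ?prob_ge0 ?prob_le1 ?subr_ge0 // gerBl ltW.
Qed.

(* [2 * delta / 3] maximizes the exponent [delta * l - 3 / 4 * l ^+ 2] that
   [expRN_le_quadratic] leaves in [exp_markov_hits_le]. *)
Lemma chernoff_lower_tail (C : {set T}) w (mu delta : R) :
  0 <= delta -> 0 <= mu <= #|I|%:R * prob R C -> w%:R <= (1 - delta) * mu ->
  prob R (hits_le I C w) <= expR (- (delta ^+ 2 * mu / 3)).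
Proof.
move=> delta0 /andP[mu0 mu_le] w_le; pose l := 2 * delta / 3.
have l0 : 0 <= l by rewrite divr_ge0 // mulr_ge0.
apply: le_trans (exp_markov_hits_le C w l0) _; rewrite ler_expR.
have -> : - (delta ^+ 2 * mu / 3) =
  l * ((1 - delta) * mu) - mu * (l - 3 / 4 * l ^+ 2) by rewrite /l; field.
apply: lerB; first by rewrite ler_wpM2l.
have expR_le := expRN_le_quadratic l0.
apply: (@le_trans _ _ (mu * (1 - expR (- l)))).
  by rewrite ler_wpM2l //; lra.
by rewrite ler_wpM2r // subr_ge0 expR_le1 oppr_le0.
Qed.

Lemma prob_many_hits_ge (J : finType) (C : J -> {set T}) w (mu delta b : R) :
  (0 < #|J|)%N -> 0 < b -> 0 <= delta -> 0 <= mu ->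
  (forall j, mu <= #|I|%:R * prob R (C j)) -> w%:R <= (1 - delta) * mu ->
  ln (#|J|%:R / b) <= delta ^+ 2 * mu / 3 ->
  1 - b <= prob R (~: \bigcup_j hits_le I (C j) w).
Proof.
move=> J_gt0 b0 delta0 mu0 mu_le w_le ln_le.
have J0 : 0 < #|J|%:R :> R by rewrite ltr0n.
rewrite prob_setC ?card_ffun ?expn_gt0 ?T_gt0 // lerD2l lerN2.
apply: le_trans (prob_bigcup _ _) _.
apply: (@le_trans _ _ (\sum_(j : J) b / #|J|%:R)); last first.
  by rewrite sumr_const -[_ *+ _]mulr_natr divfK ?gt_eqF.
apply: ler_sum => j _.
apply: le_trans (chernoff_lower_tail delta0 _ w_le) _.
  by rewrite mu0 mu_le.
rewrite -[leRHS]lnK ?posrE ?divr_gt0 // ler_expR lerNl -lnV ?posrE ?divr_gt0 //.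
by rewrite invf_div.
Qed.

End Chernoff.

Lemma prob_representative_ge (R : realType) (T J : finType) (bad : {set T})
    (C : J -> {set T}) (m w : nat) (mu delta b : R) :
  (0 < #|T|)%N -> (0 < #|J|)%N -> 0 < b <= 1 -> 0 <= delta -> 0 <= mu ->
  (forall j, [disjoint bad & C j]) ->
  m%:R * prob R bad <= b * w.+1%:R ->
  (forall j, mu <= m%:R * prob R (C j)) -> w%:R <= (1 - delta) * mu ->
  ln (#|J|%:R / b) <= delta ^+ 2 * mu / 3 ->
  (1 - b) ^+ 2 <= prob R (representative bad C m w).
Proof.
move=> T_gt0 J_gt0 /andP[b0 b1] delta0 mu0 bad_C bad_le mu_le w_le ln_le.
have few : 1 - b <= prob R (hits_le 'I_m bad w).
  by apply: markov_hits_le; rewrite ?card_ord.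
have many : 1 - b <= prob R (~: \bigcup_j hits_le 'I_m (C j) w).
  apply: (prob_many_hits_ge T_gt0 J_gt0 b0 delta0 mu0 _ w_le ln_le) => j.
  by rewrite card_ord.
apply: le_trans (mul_prob_le_representative R m w bad_C).
by rewrite expr2 ler_pM ?subr_ge0.
Qed.

(** * Distances and clustering cost *)

Section FiniteInf.
Variables (R : realType) (T : finType) (A : set T) (F : T -> R).

Lemma inf_fin_attained x0 : A x0 ->
  exists x, [/\ A x, inf [set F y | y in A]%classic = F x &
                 forall y, A y -> F x <= F y].
Proof.
move=> /[dup] Ax0 /asboolP Px0.
case: (@arg_minP _ _ _ x0 (fun x => `[< A x >]) F Px0) => x /asboolP Ax min_x.
have {}min_x y : A y -> F x <= F y by move=> Ay; apply: min_x; apply/asboolP.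
exists x; split => //; apply/le_anti/andP; split.
  by apply: ge_inf; [exists (F x) => _ [y Ay <-]; apply: min_x|exists x].
by apply: lb_le_inf; [exists (F x); exists x|move=> _ [y Ay <-]; apply: min_x].
Qed.

Lemma inf_fin_le x : A x -> inf [set F y | y in A]%classic <= F x.
Proof. by move=> Ax; have [y [_ -> ]] := inf_fin_attained Ax; apply. Qed.

End FiniteInf.

Lemma exists_subset_card (T : finType) (B : {set T}) p : (p <= #|B|)%N ->
  exists2 A : {set T}, A \subset B & #|A| = p.
Proof.
move=> pB; have : (0 < #|[set A : {set T} | (A \subset B) && (#|A| == p)]|)%N.
  by rewrite cards_draws bin_gt0.
by case/card_gt0P => A; rewrite inE => /andP[AB /eqP Ap]; exists A.
Qed.

Section EuclideanDistance.
Variables (R : realType) (D : nat).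
Implicit Types p q o : 'rV[R]_D.

Lemma edistC p q : edist p q = edist q p.
Proof. by congr Num.sqrt; apply: eq_bigr => i _; rewrite -sqrrN opprB. Qed.

Lemma edist_triangle p q o : edist p o <= edist p q + edist q o.
Proof.
rewrite -ler_sqr ?nnegrE ?addr_ge0 ?sqrtr_ge0 // sqrrD.
pose a i := p ord0 i - q ord0 i; pose b i := q ord0 i - o ord0 i.
have sum_sqr_ge0 (c : 'I_D -> R) : 0 <= \sum_i c i ^+ 2.
  by apply: sumr_ge0 => i _; apply: sqr_ge0.
rewrite !sqr_sqrtr ?(sum_sqr_ge0 (fun i => p ord0 i - o ord0 i))
  ?(sum_sqr_ge0 a) ?(sum_sqr_ge0 b) //.
rewrite (eq_bigr (fun i => a i ^+ 2 + 2 * (a i * b i) + b i ^+ 2)); last first.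
  by move=> i _; rewrite /a /b; ring.
rewrite !big_split /= -mulr_sumr lerD2r lerD2l -[leRHS]mulr_natl ler_wpM2l //.
rewrite /edist -sqrtrM ?(sum_sqr_ge0 a) //.
apply: le_trans (ler_norm _) _; rewrite -sqrtr_sqr ler_wsqrtr //.
exact: (cauchy_schwarz_sum a b).
Qed.

Section Centers.
Variables (k : nat) (H : 'I_k -> 'rV[R]_D).

Lemma distC_le p j : distC p H <= edist p (H j).
Proof. exact: (inf_fin_le (fun j => edist p (H j)) (x := j)). Qed.

Lemma distC_triangle p q : (0 < k)%N -> distC p H <= edist p q + distC q H.
Proof.
move=> k0; rewrite {2}/distC.
have [j [_ -> _]] := @inf_fin_attained R _ classical_sets.setT
  (fun j => edist q (H j)) (Ordinal k0) I.
exact: le_trans (distC_le p j) (edist_triangle _ _ _).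
Qed.

End Centers.
End EuclideanDistance.

Section DeltaTheory.
Variables (R : realType) (D m : nat) (Q : 'I_m -> 'rV[R]_D) (w k : nat).
Implicit Types (H : 'I_k -> 'rV[R]_D) (A B : {set 'I_m}).

Lemma Delta_le H (r : R) B : (m - w <= #|B|)%N -> 0 <= r ->
  (forall i, i \in B -> distC (Q i) H <= r) -> Delta Q w H <= r.
Proof.
move=> /exists_subset_card[A /subsetP AB cardA] r0 B_le.
apply: le_trans (inf_fin_le (A := fun A : {set 'I_m} => #|A| = (m - w)%N)
  _ cardA) _ => /=.
by apply: bigmax_le => // i /AB /B_le.
Qed.

Lemma Delta_attained H : exists2 A : {set 'I_m}, #|A| = (m - w)%N &
  Delta Q w H = \big[Num.max/0]_(i in A) distC (Q i) H.
Proof.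
have [|A0 _ cardA0] := @exists_subset_card _ [set: 'I_m] (m - w).
  by rewrite cardsT card_ord leq_subr.
have [A [cardA DeltaE _]] := @inf_fin_attained R _
  (fun A : {set 'I_m} => #|A| = (m - w)%N)
  (fun A => \big[Num.max/0]_(i in A) distC (Q i) H) A0 cardA0.
by exists A.
Qed.

Lemma Delta_ge0 H : 0 <= Delta Q w H.
Proof. by have [A _ ->] := Delta_attained H; apply: bigmax_ge_id. Qed.

Lemma exists_distC_le_Delta H B : (w < #|B|)%N ->
  exists2 i, i \in B & distC (Q i) H <= Delta Q w H.
Proof.
move=> wB; have [A cardA ->] := Delta_attained H.
have /subsetPn[i iB] : ~~ (B \subset ~: A).
  apply: contraL wB => /subset_leq_card; rewrite -leqNgt => /leq_trans; apply.
  by rewrite cardsCs setCK card_ord cardA; lia.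
rewrite inE negbK => iA; exists i => //.
exact: (le_bigmax_cond _ (fun i => distC (Q i) H)).
Qed.

Lemma kc_opt_ge0 : 0 <= kc_opt Q w k.
Proof.
apply: lb_le_inf; first by exists (Delta Q w (fun _ : 'I_k => 0)), (fun=> 0).
by move=> _ [H _ <-]; apply: Delta_ge0.
Qed.

Lemma kc_opt_le H : kc_opt Q w k <= Delta Q w H.
Proof.
by apply: ge_inf; [exists 0 => _ [H' _ <-]; apply: Delta_ge0|exists H].
Qed.

End DeltaTheory.

Definition cluster (T J : finType) (A : {set T}) (f : T -> J) (j : J) :
    {set T} :=
  [set x in A | f x == j].

Lemma disjoint_setC_cluster (T J : finType) (A : {set T}) (f : T -> J) j :
  [disjoint ~: A & cluster A f j].
Proof.
rewrite disjoint_sym disjoints_subset setCK.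
by apply/subsetP => i; rewrite inE => /andP[].
Qed.

(* Only [w] samples are discarded by [H], so every cluster keeps a sample, which
   links the whole cluster to [H] through the cluster's center. *)
Lemma Delta_le_of_sample (R : realType) (D n m k z w : nat)
    (P : 'I_n -> 'rV[R]_D) (s : {ffun 'I_m -> 'I_n}) (Popt : {set 'I_n})
    (f : 'I_n -> 'I_k) (Copt H : 'I_k -> 'rV[R]_D) (c r : R) :
  #|Popt| = (n - z)%N -> 0 <= c -> 0 <= r ->
  (forall i, i \in Popt -> edist (P i) (Copt (f i)) <= r) ->
  s \in representative (~: Popt) (cluster Popt f) m w ->
  Delta (fun i => P (s i)) w H <= c * kc_opt (fun i => P (s i)) w k ->
  Delta P z H <= (c + 2) * r.
Proof.
move=> cardPopt c0 r0 Popt_le.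
case/representativeP => few_outliers many_hits approx.
have opt_le : kc_opt (fun i => P (s i)) w k <= r.
  apply: le_trans (kc_opt_le _ _ Copt) _.
  apply: (Delta_le (B := s @^-1: Popt)) => // [|i]; last first.
    by rewrite inE => /Popt_le; apply: le_trans (distC_le _ _ _).
  rewrite leq_subLR -{1}(card_ord m) -(cardsC (s @^-1: Popt)) -preimsetC addnC.
  by rewrite leq_add2r.
apply: (Delta_le (B := Popt)) => [||x xPopt]; first by rewrite cardPopt.
  by rewrite mulr_ge0 // addr_ge0.
have [i] := exists_distC_le_Delta (fun i => P (s i)) H (many_hits (f x)).
rewrite !inE => /andP[siPopt /eqP fsi] si_le.
have k_gt0 : (0 < k)%N by apply: leq_ltn_trans (ltn_ord (f x)).
have x_si : edist (P x) (P (s i)) <= r + r.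
  apply: le_trans (edist_triangle _ (Copt (f x)) _) _.
  by rewrite lerD ?Popt_le // edistC -fsi Popt_le.
have si_H : distC (P (s i)) H <= c * r.
  by apply: le_trans si_le (le_trans approx _); rewrite ler_wpM2l.
by apply: le_trans (distC_triangle H (P x) (P (s i)) k_gt0) _; lra.
Qed.

Lemma significant_prob (R : realType) (D n k z : nat) (P : 'I_n -> 'rV[R]_D)
    (e1 e2 : R) :
  (z < n)%N -> significant P k z e1 e2 ->
  exists (Copt : 'I_k -> 'rV[R]_D) (Popt : {set 'I_n}) (f : 'I_n -> 'I_k),
    [/\ #|Popt| = (n - z)%N,
        forall i, i \in Popt -> edist (P i) (Copt (f i)) <= kc_opt P z k,
        prob R (~: Popt) = e2 / k%:R &
        forall j, e1 / k%:R <= prob R (cluster Popt f j)].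
Proof.
move=> zn [zE [Copt [Popt [f [_ cardPopt inliers big]]]]].
have n_gt0 : (0 < n)%N by apply: leq_ltn_trans zn.
have n0 : 0 < n%:R :> R by rewrite ltr0n.
exists Copt, Popt, f; split=> // [i /inliers[-> //]||j].
- rewrite prob_setC /prob ?cardPopt card_ord // natrB ?(ltnW zn) // zE.
  by rewrite mulrBl divff ?gt_eqF // subKr mulfK ?gt_eqF.
- by rewrite /prob card_ord ler_pdivlMr //; exact: big.
Qed.

Lemma outlier_budget_le (R : realFieldType) (eta delta e1 e2 k m : R) :
  0 < eta -> 0 < e2 -> 0 < k -> 0 <= m ->
  0 < eta * (1 - delta) -> 1 / (eta * (1 - delta)) < e1 / e2 ->
  1 / eta * (e2 / k) * m <= (1 - delta) * (m * (e1 / k)).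
Proof.
move=> eta0 e2_0 k0 m0 eta_delta0 ratio.
have e2_le : e2 <= eta * (1 - delta) * e1.
  move/ltW: ratio.
  by rewrite ler_pdivrMr // mulrAC ler_pdivlMr // mul1r [leRHS]mulrC.
have -> : 1 / eta * (e2 / k) * m = m / (eta * k) * e2 by field; rewrite !gt_eqF.
have -> : (1 - delta) * (m * (e1 / k)) =
    m / (eta * k) * (eta * (1 - delta) * e1).
  by field; rewrite !gt_eqF.
by rewrite ler_wpM2l // divr_ge0 // mulr_ge0 // ltW.
Qed.

Lemma ln_le_sample_size (R : realType) (eta delta e1 k m : R) :
  0 < eta -> 0 < delta -> 0 < e1 -> 0 < k ->
  3 * k / (delta ^+ 2 * e1) * ln (2 * k / eta) <= m ->
  ln (k / eta) <= delta ^+ 2 * (m * (e1 / k)) / 3.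
Proof.
move=> eta0 delta0 e1_0 k0 size_le; apply: (@le_trans _ _ (ln (2 * k / eta))).
  rewrite ler_ln ?posrE ?divr_gt0 ?mulr_gt0 //.
  by rewrite ler_wpM2r ?invr_ge0 ?(ltW eta0) //; lra.
have -> : delta ^+ 2 * (m * (e1 / k)) / 3 = m / (3 * k / (delta ^+ 2 * e1)).
  by field; rewrite !gt_eqF.
by rewrite ler_pdivlMr ?(divr_gt0, mulr_gt0, exprn_gt0) // [leLHS]mulrC.
Qed.

Theorem theorem2 (R : realType) (D n k z m z' : nat)
    (P : 'I_n -> 'rV[R]_D) (e1 e2 eta delta c : R)
    (alg : ('I_m -> 'rV[R]_D) -> 'I_k -> 'rV[R]_D) :
  injective P -> (0 < k)%N -> (0 < z < n)%N ->
  0 < e1 -> 0 < e2 -> significant P k z e1 e2 ->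
  0 < eta < 1 -> 0 < delta < 1 ->
  (* |S| = m = ceil (3k/(delta^2 eps1) * log (2k/eta)) *)
  (let X := 3 * k%:R / (delta ^+ 2 * e1) * ln (2 * k%:R / eta) in
     X <= m%:R < X + 1) ->
  (* z' = floor (1/eta * eps2/k * |S|) *)
  (let Y := 1 / eta * (e2 / k%:R) * m%:R in z'%:R <= Y < z'%:R + 1) ->
  1 <= c ->
  (* alg is a c-approximation for k-center with z' outliers on samples *)
  (forall S : 'I_m -> 'rV[R]_D, Delta S z' (alg S) <= c * kc_opt S z' k) ->
  e1 / e2 > 1 / (eta * (1 - delta)) ->
  (1 - eta) ^+ 2 <=
    #|[set s : {ffun 'I_m -> 'I_n}
        | Delta P z (alg (fun i => P (s i))) <= (c + 2) * kc_opt P z k]|%:R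
    / (n ^ m)%:R.
Proof.
move=> _ k_gt0 /andP[_ zn] e1_0 e2_0 /(significant_prob zn).
move=> [Copt [Popt [f [cardPopt inliers prob_outlier prob_cluster]]]].
move=> /andP[eta0 eta1] /andP[delta0 delta1] /= /andP[mX _] /andP[zY Yz].
move=> c1 approx ratio; have k0 : 0 < k%:R :> R by rewrite ltr0n.
have mu_ge0 : 0 <= m%:R * (e1 / k%:R) by rewrite mulr_ge0 // divr_ge0 // ltW.
pose good := representative (~: Popt) (cluster Popt f) m z'.
apply: (@le_trans _ _ (prob R good)).
  apply: (prob_representative_ge _ _ _ (ltW delta0) mu_ge0);
    rewrite ?card_ord ?eta0 ?(ltW eta1) ?(leq_ltn_trans _ zn) //.
  - exact: disjoint_setC_cluster.
  - by rewrite prob_outlier -natr1 mulrC -ler_pdivrMl // -div1r mulrA ltW.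
  - by move=> j; rewrite ler_wpM2l.
  - apply: le_trans zY (outlier_budget_le _ _ _ _ _ ratio) => //.
    by rewrite mulr_gt0 ?subr_gt0.
  - exact: ln_le_sample_size mX.
have -> : (n ^ m)%N = #|{ffun 'I_m -> 'I_n}| by rewrite card_ffun !card_ord.
apply: le_prob; apply/subsetP => s s_good; rewrite inE.
apply: (Delta_le_of_sample cardPopt _ _ inliers s_good (approx _)).
- exact: le_trans c1.
- exact: kc_opt_ge0.
Qed.
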